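(* Let $n$ be a positive integer, $k\in\{1,\dots,n\}$, and let $A,B\colon[0,1]^n\to[0,1]$ be $n$-variate semicopulas with $A\le B$. Then the following statements are equivalent: (i) There exists a $k$-increasing $n$-variate semicopula $C\colon[0,1]^n\to[0,1]$ such that $A\le C\le B$. (ii) For all $\mathbf R\in\mathcal R_k([0,1]^n)$: $L_k^{(A,B)}(\mathbf R)\ge 0$.
   Context: Write $\mathbb I=[0,1]$; $\le$ between functions is the pointwise order, and ''increasing'' means non-decreasing. Boxes. For $\mathbf x,\mathbf y\in\mathbb I^n$, the product $R=[\mathbf x,\mathbf y]=\prod_{i=1}^n[x_i,y_i]$ is a $k$-box if $x_i<y_i$ for exactly $k$ indices $i$ and $x_i=y_i$ for the remaining $n-k$ indices. Its vertices are $\operatorname{ver}R=\prod_{i=1}^n\{x_i,y_i\}$. The sign of a vertex $\mathbf v$ is $\operatorname{sign}_R(\mathbf v)=(-1)^{m-(n-k)}$, where $m=|\{i: v_i=x_i\}|$. The multiplicity of $\mathbf u\in\mathbb I^n$ with respect to $R$ is $m_R(\mathbf u)=\operatorname{sign}_R(\mathbf u)$ if $\mathbf u\in\operatorname{ver}R$ and $0$ otherwise. $\mathcal R_k(\mathbb I^n)$ is the set of formal finite disjoint unions $\mathbf R=\bigsqcup_{j=1}^s R_j$ of $k$-boxes with vertices in $\mathbb I^n$, i.e. finite families (multisets) of $k$-boxes, where repetitions and overlaps are allowed; $m_{\mathbf R}(\mathbf u)=\sum_{j=1}^s m_{R_j}(\mathbf u)$. For functions $A\le B$ on $\mathbb I^n$,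 $$L_k^{(A,B)}(\mathbf R)=\sum_{\mathbf y:\,m_{\mathbf R}(\mathbf y)>0}m_{\mathbf R}(\mathbf y)B(\mathbf y)+\sum_{\mathbf y:\,m_{\mathbf R}(\mathbf y)<0}m_{\mathbf R}(\mathbf y)A(\mathbf y)$$ (finite sums over $\mathbf y\in\mathbb I^n$). Functions. $f\colon\mathbb I^n\to\mathbb I$ is $k$-increasing if $\sum_{\mathbf v\in\operatorname{ver}R}\operatorname{sign}_R(\mathbf v)f(\mathbf v)\ge0$ for every $k$-box $R$ in $\mathbb I^n$ ($1$-increasing means increasing in each variable); grounded if $f(\mathbf x)=0$ whenever some $x_i=0$; it has uniform marginals if $f(1,\dots,1,x_i,1,\dots,1)=x_i$ for all $x_i\in\mathbb I$ and all $i$. A semicopula is a grounded, $1$-increasing function $\mathbb I^n\to\mathbb I$ with uniform marginals. *)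

(* Defs.v *)
From mathcomp Require Import all_boot all_order all_algebra.
From mathcomp Require Import boolp classical_sets fsbigop reals interval_inference.

Set Implicit Arguments.
Unset Strict Implicit.
Unset Printing Implicit Defensive.

Import Order.TTheory GRing.Theory Num.Theory.

Local Open Scope classical_set_scope.
Local Open Scope ring_scope.

Section Boxes.
Variables (R : realType) (n : nat).

Definition cube := {ffun 'I_n -> {i01 R}}.

(* The pair (x, y) stands for the product [x, y]; it is only a box under the
   ordering condition imposed by kbox. *)
Definition box := (cube * cube)%type.

Implicit Types (Q : box) (Qs : seq box) (u v x : cube).

Definition boxdim Q : nat := #|[set i | Q.1 i < Q.2 i]%SET|.

Definition kbox (k : nat) Q : bool :=
  [forall i, Q.1 i <= Q.2 i] && (boxdim Q == k).

Definition ver Q : set cube := [set v | forall i, v i = Q.1 i \/ v i = Q.2 i].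

(* The truncated subtractions are exact at the vertices of a box: every v in
   ver Q agrees with Q.1 on the n - boxdim Q degenerate coordinates. *)
Definition sign Q v : int :=
  (-1) ^+ (#|[set i | v i == Q.1 i]%SET| - (n - boxdim Q)).

Definition box_mult Q u : int := if u \in ver Q then sign Q u else 0.

(* A formal finite disjoint union of boxes is a list of boxes, repetitions
   allowed; the order of the list does not affect the multiplicities. *)
Definition mult Qs u : int := \sum_(Q <- Qs) box_mult Q u.

Definition Lform (A B : cube -> {i01 R}) Qs : R :=
  \sum_(y \in [set y | 0 < mult Qs y]) (mult Qs y)%:~R * (B y)%:num +
  \sum_(y \in [set y | mult Qs y < 0]) (mult Qs y)%:~R * (A y)%:num.

Definition k_increasing (k : nat) (f : cube -> {i01 R}) : Prop :=
  forall Q, kbox k Q -> 0 <= \sum_(v \in ver Q) (sign Q v)%:~R * (f v)%:num :> R.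

Definition grounded (f : cube -> {i01 R}) : Prop :=
  forall x i, x i = 0%:i01 -> f x = 0%:i01.

Definition uniform_marginals (f : cube -> {i01 R}) : Prop :=
  forall i (t : {i01 R}), f [ffun j => if j == i then t else 1%:i01] = t.

Definition semicopula (f : cube -> {i01 R}) : Prop :=
  [/\ grounded f, k_increasing 1 f & uniform_marginals f].

Definition le_fun (f g : cube -> {i01 R}) : Prop :=
  forall x, f x <= g x.

End Boxes.

(* Main.v *)
(** The semicopula conditions other than k-increasingness come for free: a
    function between two semicopulas is grounded with uniform marginals, and a
    grounded k-increasing function is 1-increasing.  What remains is a sandwich
    problem.  Among the pairs A <= A' <= B' <= B on which the functionals
    [Lform] stay nonnegative, Zorn's lemma gives a tightest one.  If A' u < B' u
    at some point u, then moving one of the two bounds at u to their midpoint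
    preserves nonnegativity, contradicting tightness.  Hence A' = B' = C, and
    nonnegativity on single boxes says that C is k-increasing. *)
Require Import Defs.
From mathcomp Require Import all_boot all_order all_algebra.
From mathcomp Require Import boolp classical_sets fsbigop reals interval_inference.
From mathcomp Require Import lra zify.

Set Implicit Arguments.
Unset Strict Implicit.
Unset Printing Implicit Defensive.

Import Order.TTheory GRing.Theory Num.Theory.
Local Open Scope ring_scope.

(** * Pointwise cost of an integer multiplicity *)

Section Cost.
Context {R : realType}.
Implicit Types (a b c e : R) (z : int).

Definition cost a b z : R := z%:~R * (if 0 < z then b else a).

Lemma cost0 a b : cost a b 0 = 0.
Proof. by rewrite /cost mul0r. Qed.

Lemma cost_diag c z : cost c c z = z%:~R * c.
Proof. by rewrite /cost; case: ifP. Qed.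

(** As a maximum of two linear functions of [z], the cost is sublinear; [costD] and [cost_mulrn] are
    read off from this form. *)
Lemma cost_maxE a b z : a <= b -> cost a b z = Num.max (z%:~R * a) (z%:~R * b).
Proof.
move=> ab; rewrite /cost; case: ltP => z0.
  by rewrite max_r// ler_wpM2l// ler0z ltW.
by rewrite max_l// ler_wnM2l// lerz0.
Qed.

Lemma costD a b z1 z2 : a <= b -> cost a b (z1 + z2) <= cost a b z1 + cost a b z2.
Proof.
move=> ab; rewrite !cost_maxE// intrD !mulrDl ge_max.
by rewrite !lerD// le_max lexx// orbT.
Qed.

Lemma cost_mulrn a b z p : a <= b -> cost a b (z *+ p) = cost a b z *+ p.
Proof.
move=> ab; rewrite !cost_maxE// -mulr_natl intrM natz -pmulrn.
by rewrite -[RHS]mulr_natl maxr_pMr ?ler0n// !mulrA.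
Qed.

Lemma cost_lipschitz a b a' b' e z :
  a' - e <= a -> b <= b' + e -> cost a b z <= cost a' b' z + `|z|%:~R * e.
Proof.
move=> aa bb; rewrite /cost; case: ltP => z0.
  by rewrite gtr0_norm// -mulrDr ler_wpM2l// ler0z ltW.
by rewrite ler0_norm// intrN mulNr -mulrBr ler_wnM2l// lerz0.
Qed.

Lemma cost_le a b a' b' z : a' <= a -> b <= b' -> cost a b z <= cost a' b' z.
Proof.
move=> aa bb; have := @cost_lipschitz a b a' b' 0 z.
by rewrite subr0 mulr0 !addr0; exact.
Qed.

End Cost.

(** * Sandwich theorem for an additive family of integer multiplicities *)

Section Sandwich.
Context {R : realType} {T : eqType}.
Implicit Types (A B C f g : T -> R) (m : T -> int) (s : seq T).

(** A covering list may exceed the support, so that several multiplicities can be summed over one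
    common list. *)
Definition covers s m := uniq s /\ forall y, m y != 0 -> y \in s.

Definition total_cost A B m s : R := \sum_(y <- s) cost (A y) (B y) (m y).

Lemma eq_sum_covers (F : T -> R) m s s' : (forall y, m y = 0 -> F y = 0) ->
  covers s m -> covers s' m -> \sum_(y <- s) F y = \sum_(y <- s') F y.
Proof.
move=> F0 [us sm] [us' sm'].
have red t : \sum_(y <- t) F y = \sum_(y <- t | m y != 0) F y.
  rewrite [LHS](bigID (fun y => m y != 0))/= [X in _ + X]big1 ?addr0//.
  by move=> y /negPn/eqP/F0.
rewrite red [RHS]red -big_filter -[RHS]big_filter; apply: perm_big.
apply: uniq_perm; rewrite ?filter_uniq// => y; rewrite !mem_filter.
by have [//|my] := eqVneq (m y) 0; rewrite /= sm// sm'.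
Qed.

Lemma eq_total_cost A B m s s' : covers s m -> covers s' m ->
  total_cost A B m s = total_cost A B m s'.
Proof. by apply: eq_sum_covers => y ->; rewrite cost0. Qed.

Definition feasible (M : set (T -> int)) A B :=
  forall m s, M m -> covers s m -> 0 <= total_cost A B m s.

Definition update f u (c : R) := fun y => if y == u then c else f y.

Section Interpolation.
Variable M : set (T -> int).
Hypothesis M_add : forall m1 m2, M m1 -> M m2 -> M (fun y => m1 y + m2 y).

Lemma M_mulrn m p : M m -> M (fun y => m y *+ p.+1).
Proof.
move=> Mm; elim: p => [|p IH]; first by rewrite (_ : (fun _ => _) = m).
rewrite (_ : (fun _ => _) = fun y => m y + m y *+ p.+1); first exact: M_add.
by apply/funext => y; rewrite mulrS.
Qed.

(* If both updates failed, the two violating combinations could be rescaled so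
   that their multiplicities at u cancel; their sum would then be a combination
   of negative cost for (A, B) itself. *)
Lemma feasible_update A B u c : (forall y, A y <= B y) -> A u <= c <= B u ->
  feasible M A B -> feasible M (update A u c) B \/ feasible M A (update B u c).
Proof.
move=> AB /andP[Ac cB] fAB; apply: contrapT => /not_orP[].
move=> /existsNP[m1 /existsNP[s1 /not_implyP[Mm1 /not_implyP[c1 N1]]]].
move=> /existsNP[m2 /existsNP[s2 /not_implyP[Mm2 /not_implyP[c2 N2]]]].
move/negP: N1; move/negP: N2; rewrite -!ltNge => N2 N1.
(* The lower bound at [u] only enters the cost when the multiplicity there is negative; otherwise
   the update changes nothing. *)
have m1u : m1 u < 0.
  rewrite ltNge; apply/negP => m1u; move: N1; rewrite ltNge => /negP; apply.
  rewrite (_ : total_cost _ _ _ _ = total_cost A B m1 s1); first exact: fAB.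
  apply: eq_bigr => y _; rewrite /update; case: eqP => // ->.
  by rewrite /cost; case: ltgtP m1u => // <-; rewrite !mul0r.
have m2u : 0 < m2 u.
  rewrite ltNge; apply/negP => m2u; move: N2; rewrite ltNge => /negP; apply.
  rewrite (_ : total_cost _ _ _ _ = total_cost A B m2 s2); first exact: fAB.
  apply: eq_bigr => y _; rewrite /update; case: eqP => // ->.
  by rewrite /cost ltNge m2u.
have [p Ep] : exists p, m2 u = p.+1%:Z by case: (m2 u) m2u => // -[]// p; exists p.
have [q Eq] : exists q, m1 u = - q.+1%:Z.
  by case: (m1 u) m1u => // q; exists q; rewrite NegzE.
(* The factors are [m2 u] and [- m1 u], so [m u = 0]. At [u] both updated costs use the same value
   [c], hence they cancel as well. *)
pose m y := m1 y *+ p.+1 + m2 y *+ q.+1.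
pose s := undup (s1 ++ s2).
have cs1 : covers s m1.
  split=> [|y /c1.2]; first exact: undup_uniq.
  by rewrite mem_undup mem_cat => ->.
have cs2 : covers s m2.
  split=> [|y /c2.2]; first exact: undup_uniq.
  by rewrite mem_undup mem_cat => ->; rewrite orbT.
have cs : covers s m.
  split=> [|y]; first exact: undup_uniq.
  apply: contraNT => ys; apply/eqP; rewrite /m.
  have [->|/cs1.2 ys1] := eqVneq (m1 y) 0; last by rewrite ys1 in ys.
  have [->|/cs2.2 ys2] := eqVneq (m2 y) 0; last by rewrite ys2 in ys.
  by rewrite !mul0rn.
rewrite (eq_total_cost _ _ c1 cs1) in N1; rewrite (eq_total_cost _ _ c2 cs2) in N2.
have : total_cost A B m s <=
    total_cost (update A u c) B m1 s *+ p.+1 + total_cost A (update B u c) m2 s *+ q.+1.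
  rewrite /total_cost -!sumrMnl -big_split/=; apply: ler_sum => y _.
  rewrite /update; case: eqP => [->|_].
    rewrite /m Ep Eq (_ : _ + _ = 0) ?cost0; last first.
      by rewrite -!natz mulNrn -!mulrnA mulnC addNr.
    rewrite /cost oppr_gt0/= mulrNz -!pmulrn mulNr mulNrn -!mulrnAl.
    by rewrite -!mulrnA mulnC addNr.
  by rewrite -!cost_mulrn//; apply: costD.
rewrite leNgt => /negP; apply; apply: lt_le_trans (fAB _ _ _ cs).
  by rewrite -[ltRHS]addr0 ltrD// pmulrn_llt0.
by apply: M_add; exact: M_mulrn.
Qed.

(** The bound is the pointwise supremum of the lower functions with the pointwise infimum of the
    upper ones. Feasibility survives the limit because each total cost involves only finitely many
    points. *)
Lemma feasible_chain (F : set ((T -> R) * (T -> R))) A B :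
  (forall y, A y <= B y) ->
  (forall p q, F p -> F q ->
     (forall y, p.1 y <= q.1 y /\ q.2 y <= p.2 y) \/
     (forall y, q.1 y <= p.1 y /\ p.2 y <= q.2 y)) ->
  (forall p, F p -> (forall y, [/\ A y <= p.1 y, p.1 y <= p.2 y & p.2 y <= B y]) /\
     feasible M p.1 p.2) ->
  (exists p, F p) ->
  exists q, [/\ forall p, F p -> forall y, p.1 y <= q.1 y /\ q.2 y <= p.2 y,
    (forall y, [/\ A y <= q.1 y, q.1 y <= q.2 y & q.2 y <= B y]) & feasible M q.1 q.2].
Proof.
move=> AB chainF hF [p0 Fp0].
pose lo y := [set p.1 y | p in F]%classic; pose hi y := [set p.2 y | p in F]%classic.
have lohi p q y : F p -> F q -> p.1 y <= q.2 y.
  move=> Fp Fq; have [_ pp _] := (hF _ Fp).1 y; have [_ qq _] := (hF _ Fq).1 y.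
  by have [/(_ y)[]|/(_ y)[]] := chainF _ _ Fp Fq; lra.
have sup_lo y : has_sup (lo y).
  split; first by exists (p0.1 y), p0.
  by exists (p0.2 y) => _ [p Fp <-]; exact: lohi.
have inf_hi y : has_inf (hi y).
  split; first by exists (p0.2 y), p0.
  by exists (p0.1 y) => _ [p Fp <-]; exact: lohi.
pose q := (fun y => sup (lo y), fun y => inf (hi y)).
have lo_q p y : F p -> p.1 y <= q.1 y.
  by move=> Fp; apply: ub_le_sup; [exact: (sup_lo y).2|exists p].
have q_hi p y : F p -> q.2 y <= p.2 y.
  by move=> Fp; apply: ge_inf; [exact: (inf_hi y).2|exists p].
(* One member of the chain is [e]-close to the limit on all of [s]: finitely many members have a
   tightest one. *)
have approx (e : R) s : 0 < e ->
    exists2 p, F p & {in s, forall y, q.1 y - e <= p.1 y /\ p.2 y <= q.2 y + e}.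
  move=> e0; elim: s => [|y s [p Fp IH]]; first by exists p0.
  have [_ [p1 Fp1 <-] lt1] := sup_adherent e0 (sup_lo y).
  have [_ [p2 Fp2 <-] lt2] := inf_adherent e0 (inf_hi y).
  have join p' p'' : F p' -> F p'' -> exists2 r, F r & forall y,
      [/\ p'.1 y <= r.1 y, r.2 y <= p'.2 y, p''.1 y <= r.1 y & r.2 y <= p''.2 y].
    move=> F' F''; have [le|le] := chainF _ _ F' F''.
      by exists p'' => // z; have [] := le z; split.
    by exists p' => // z; have [] := le z; split.
  have [r Fr r12] := join _ _ Fp1 Fp2; have [t Ft tpr] := join _ _ Fp Fr.
  exists t => // z; rewrite inE => /orP[/eqP->|/IH].
    by have [? ? ? ?] := r12 y; have [? ? ? ?] := tpr y; rewrite /=; split; lra.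
  by have [? ? ? ?] := tpr z; move=> [? ?]; split; lra.
exists q; split.
- by move=> p Fp y; split; [exact: lo_q|exact: q_hi].
- move=> y; split.
  + by have [] := (hF _ Fp0).1 y; have := lo_q _ y Fp0; lra.
  + apply: ge_sup => [|_ [p Fp <-]]; first exact: (sup_lo y).1.
    apply: lb_le_inf => [|_ [p' Fp' <-]]; first exact: (inf_hi y).1.
    exact: lohi.
  + by have [] := (hF _ Fp0).1 y; have := q_hi _ y Fp0; lra.
move=> m s Mm cs; rewrite leNgt; apply/negP => S0.
set S := total_cost _ _ _ _ in S0; pose N : R := \sum_(y <- s) `|m y|%:~R.
have N0 : 0 <= N by apply: sumr_ge0 => y _; rewrite ler0z.
(* With this choice [S + N * e = - e < 0]; the added 1 keeps the denominator positive. *)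
pose e := - S / (N + 1).
have e0 : 0 < e by rewrite divr_gt0 ?oppr_gt0//; lra.
have eN : e * (N + 1) = - S by rewrite divfK//; lra.
have [p Fp pe] := approx e s e0.
suff : total_cost p.1 p.2 m s <= S + N * e.
  by have := (hF _ Fp).2 m s Mm cs; lra.
rewrite mulr_suml -big_split/= [leLHS]big_seq [leRHS]big_seq.
by apply: ler_sum => y /pe[? ?]; apply: cost_lipschitz.
Qed.

Theorem additive_sandwich A B : (forall y, A y <= B y) -> feasible M A B ->
  exists C, (forall y, A y <= C y <= B y) /\ feasible M C C.
Proof.
move=> AB fAB.
pose P (p : (T -> R) * (T -> R)) :=
  (forall y, [/\ A y <= p.1 y, p.1 y <= p.2 y & p.2 y <= B y]) /\ feasible M p.1 p.2.
(* Larger means tighter, so a maximal element is a tightest pair. *)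
pose le (p q : {p | P p}) :=
  `[< forall y, (sval p).1 y <= (sval q).1 y /\ (sval q).2 y <= (sval p).2 y >].
have P0 : P (A, B) by split=> // y; split => /=.
have [||F totF|[p [pAB fp]] maxp] := @ZL_preorder _ (exist P _ P0) le.
- by move=> t; apply/asboolP.
- move=> r s t /asboolP rs /asboolP st; apply/asboolP => y.
  by have [? ?] := rs y; have [? ?] := st y; split; lra.
(* The empty chain has no supremum or infimum to offer; the initial pair bounds it. *)
- have [[p0 Fp0]|F0] := pselect (exists p, F p); last first.
    by exists (exist P _ P0) => s Fs; case: F0; exists s.
  have [|||q [Fq qAB fq]] := @feasible_chain [set sval p | p in F]%classic A B AB.
  + move=> _ _ [p Fp <-] [q Fq <-].
    by have [/asboolP|/asboolP] := totF _ _ Fp Fq; [left|right].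
  + by move=> _ [p Fp <-]; exact: (svalP p).
  + by exists (sval p0), p0.
  exists (exist P q (conj qAB fq)) => s Fs; apply/asboolP => y /=.
  by apply: Fq; exists s.
have p_diag u : p.1 u = p.2 u.
  have [_ pu _] := pAB u; apply/eqP; rewrite eq_le pu/= leNgt; apply/negP => ltu.
  pose c := (p.1 u + p.2 u) / 2.
  have stuck q : P q -> (forall y, p.1 y <= q.1 y /\ q.2 y <= p.2 y) ->
      q.1 u <= p.1 u /\ p.2 u <= q.2 u.
    move=> Pq pq; suff /asboolP/(_ u) : le (exist P q Pq) (exist P p (conj pAB fp)) by [].
    by apply: maxp; apply/asboolP.
  have pp y : p.1 y <= p.2 y by have [] := pAB y.
  have cu : p.1 u <= c <= p.2 u by rewrite /c; apply/andP; split; lra.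
  have [fc|fc] := feasible_update pp cu fp.
    have [] := stuck (update p.1 u c, p.2).
    - split=> // y; rewrite /= /update; case: eqP => [->|_]; last exact: pAB.
      by have [? ? ?] := pAB u; split; lra.
    - move=> y; rewrite /= /update; case: eqP => [->|_]; split => //.
      by lra.
    - by rewrite /= /update eqxx /c; lra.
  have [] := stuck (p.1, update p.2 u c).
  - split=> // y; rewrite /= /update; case: eqP => [->|_]; last exact: pAB.
    by have [? ? ?] := pAB u; split; lra.
  - move=> y; rewrite /= /update; case: eqP => [->|_]; split => //.
    by lra.
  - by rewrite /= /update eqxx /c; lra.
exists p.1; split=> [y|]; first by have [? ? ?] := pAB y; apply/andP; split; lra.
by rewrite {2}(_ : p.1 = p.2)//; exact/funext.
Qed.
End Interpolation.
End Sandwich.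

(** * Vertex sums of boxes and the functional [Lform] *)

Section Boxes.
Context {R : realType} {n : nat}.
Implicit Types (Q : box R n) (Qs : seq (box R n)) (f A B C : cube R n -> {i01 R}).

(** Choices differing only in degenerate coordinates give the same vertex, hence [undup]. *)
Definition vertices Q : seq (cube R n) := undup
  [seq [ffun i => if b i then Q.1 i else Q.2 i] | b : {ffun 'I_n -> bool}].

Lemma mem_vertices Q v : (v \in vertices Q) = (v \in ver Q).
Proof.
rewrite mem_undup; apply/fintype.imageP/idP => [[b _ ->]|].
  by rewrite inE /ver/= => i; rewrite ffunE; case: (b i); [left|right].
rewrite inE => vQ; exists [ffun i => v i == Q.1 i] => //.
by apply/ffunP => i; rewrite !ffunE; case: eqP => // vi; have [] := vQ i.
Qed.

Lemma mult_cat Qs Qs' : mult (Qs ++ Qs') = fun y => mult Qs y + mult Qs' y.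
Proof. by apply/funext => y; rewrite /mult big_cat. Qed.

Definition all_vertices Qs := undup (flatten [seq vertices Q | Q <- Qs]).

Lemma covers_mult Qs : covers (all_vertices Qs) (mult Qs).
Proof.
split=> [|y]; first exact: undup_uniq.
apply: contraNT; rewrite mem_undup => ys; rewrite /mult big_seq big1// => Q QQs.
rewrite /box_mult -mem_vertices ifF//; apply/negbTE.
by apply: contraNN ys => yQ; apply/flatten_mapP; exists Q.
Qed.

Lemma box_sumE f Q s : uniq s -> {subset vertices Q <= s} ->
  \sum_(v \in ver Q) (sign Q v)%:~R * (f v)%:num =
  \sum_(v <- s) (box_mult Q v)%:~R * (f v)%:num :> R.
Proof.
move=> us Qs; transitivity
    (\sum_(v \in ver Q) (box_mult Q v)%:~R * (f v)%:num : R).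
  by apply: eq_fsbigr => v vQ; rewrite /box_mult vQ.
apply: fsbig_fwiden => // [v vQ|v [_ vQ]] /=.
  by apply: Qs; rewrite mem_vertices inE.
by rewrite /box_mult ifF ?mul0r//; apply/negbTE; rewrite notin_setE.
Qed.

Lemma LformE A B Qs s : covers s (mult Qs) -> Lform A B Qs =
  total_cost (fun y => (A y)%:num) (fun y => (B y)%:num) (mult Qs) s.
Proof.
move=> [us cs].
have restrict (P : pred (cube R n)) (F : cube R n -> R) :
    (forall y, P y -> mult Qs y != 0) ->
    \sum_(y \in [set y | P y]%classic) F y = \sum_(y <- s | P y) F y.
  by move=> Pm; apply/esym/bigfs => // y /Pm/cs ->.
rewrite /Lform !restrict; try by move=> y; rewrite neq_lt => ->; rewrite ?orbT.
rewrite !(big_mkcond (fun y => (_ < _)))/= -big_split; apply: eq_bigr => y _.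
by rewrite /cost; case: ltgtP => [||<-]; rewrite /= ?addr0 ?add0r ?mul0r.
Qed.

(** With equal bounds the split by sign disappears and the form is linear in the multiplicity, so
    the sums can be exchanged. *)
Lemma Lform_diag C Qs : Lform C C Qs =
  \sum_(Q <- Qs) \sum_(v \in ver Q) (sign Q v)%:~R * (C v)%:num.
Proof.
rewrite (LformE _ _ (covers_mult Qs)).
transitivity (\sum_(Q <- Qs) \sum_(v <- all_vertices Qs)
    (box_mult Q v)%:~R * (C v)%:num : R).
  rewrite exchange_big/=; apply: eq_bigr => y _.
  by rewrite cost_diag /mult rmorph_sum mulr_suml.
apply: eq_big_seq => Q QQs; apply/esym/box_sumE => [|v vQ]; first exact: undup_uniq.
by rewrite mem_undup; apply/flatten_mapP; exists Q.
Qed.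

(* Groundedness lets a 1-box be thickened downwards to 0 in k - 1 further
   directions without adding any nonzero vertex value. *)
Lemma grounded_k_increasing1 k f : (1 <= k <= n)%N ->
  grounded f -> k_increasing k f -> k_increasing 1 f.
Proof.
move=> /andP[k0 kn] f0 fk Q /andP[/forallP Qle /cards1P[i0 Qi0]].
have ltQ i : (Q.1 i < Q.2 i) = (i == i0) by move/setP/(_ i): Qi0; rewrite !inE.
have eqQ i : i != i0 -> Q.1 i = Q.2 i.
  by move=> ii0; apply/eqP; move: (Qle i); rewrite le_eqVlt ltQ (negPf ii0) orbF.
have [J] : exists J : {set 'I_n}, J \subset [set~ i0] /\ #|J| = k.-1.
  have : (k.-1 <= #|[set~ i0]|)%N by rewrite cardsC1 card_ord; lia.
  move=> /card_geqP[s [us sk ss]]; exists [set i in s]; split.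
    by apply/fintype.subsetP => i; rewrite inE => /ss.
  by rewrite cardsE (card_uniqP us).
move=> [Ji0 cJ].
have i0J : i0 \notin J by apply/negP => /(fintype.subsetP Ji0); rewrite !inE eqxx.
have JQ j : j \in J -> Q.1 j = Q.2 j.
  by move=> jJ; apply: eqQ; apply: contraNneq i0J => <-.
have [z [zle fz]] : exists z : {i01 R},
    (forall t, z <= t) /\ (forall (v : cube R n) j, v j = z -> (f v)%:num = 0 :> R).
  by exists 0%:i01; split=> [t|v j vj]; rewrite -?num_le ?ge0// (f0 v j).
(* If [Q] already lies at 0 in a direction of [J], it cannot be thickened there, but then [f]
   vanishes at all its vertices. *)
have [/existsP[j /andP[jJ /eqP Qj0]]|noz] := boolP [exists j, (j \in J) && (Q.1 j == z)].
  rewrite fsbig1// => v vQ; rewrite (fz _ j) ?mulr0//.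
  by have [->//|->] := vQ j; rewrite -JQ.
have Qpos j : j \in J -> z < Q.1 j.
  move=> jJ; rewrite lt_neqAle zle andbT.
  by apply: contraNneq noz => jz; apply/existsP; exists j; rewrite jJ -jz eqxx.
pose Q' : box R n := ([ffun i => if i \in J then z else Q.1 i], Q.2).
have Q'k : kbox k Q'.
  apply/andP; split.
    by apply/forallP => i; rewrite ffunE; case: ifP => // iJ; rewrite -JQ// ltW// Qpos.
  rewrite /boxdim (_ : [set i | _] = i0 |: J).
    by rewrite cardsU1 i0J cJ add1n prednK.
  apply/setP => i; rewrite !inE ffunE; case: ifP => [iJ|_].
    by rewrite -JQ// Qpos// orbT.
  by rewrite ltQ orbF.
have := fk _ Q'k; rewrite (_ : \sum_(v \in ver Q') _ =
  \sum_(v \in ver Q) (sign Q v)%:~R * (f v)%:num)//.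
rewrite -(fsbig_widen (ver Q))/=.
- apply: eq_fsbigr => v; rewrite inE => vQ; rewrite /sign.
  have -> : boxdim Q = 1 by rewrite /boxdim Qi0 cards1.
  have /andP[_ /eqP->] := Q'k.
  congr (_%:~R * _); congr (_ ^+ _).
  (* Along [J] a vertex of [Q] sits at the upper end of [Q']. It loses [k - 1] matches with the
     lower corner, exactly the drop from [n - 1] to [n - k], so the signs agree. *)
  have -> : [set i | v i == Q.1 i]%SET = [set i | v i == Q'.1 i]%SET :|: J.
    apply/setP => i; rewrite !inE ffunE; case: ifP => [iJ|]; last by rewrite orbF.
    by rewrite orbT; apply/eqP; have [|->] := vQ i; rewrite ?JQ.
  rewrite cardsU disjoint_setI0 ?cards0 ?subn0 ?cJ; last first.
    rewrite finset.disjoints_subset; apply/fintype.subsetP => i; rewrite !inE ffunE.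
    case: ifP => // iJ /eqP vi; move: (Qpos _ iJ).
    by have [<-|e] := vQ i; rewrite ?JQ// -?e vi ltxx.
  case: k k0 kn {cJ fk Q'k} => //= k _ kn.
  by move: #|_| => a; lia.
- move=> v vQ i /=; rewrite ffunE; case: ifP => [iJ|_]; last exact: vQ.
  by right; have [->|->//] := vQ i; rewrite JQ.
- move=> v [vQ' /=] nvQ; have [j jJ vj] : exists2 j, j \in J & v j = z.
    apply: contrapT => nj; apply: nvQ => i; have := vQ' i; rewrite /= ffunE.
    by case: ifP => // iJ [vi|]; [case: nj; exists i|right].
  by rewrite (fz _ j)// mulr0.
Qed.

End Boxes.

(** * The equivalence for semicopulas *)

Theorem theorem3p2 (R : realType) (n k : nat) (hn : (0 < n)%N)
    (hk : (1 <= k <= n)%N) (A B : cube R n -> {i01 R})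
    (hA : semicopula A) (hB : semicopula B) (hAB : le_fun A B) :
  (exists C : cube R n -> {i01 R},
      [/\ semicopula C, k_increasing k C, le_fun A C & le_fun C B])
  <-> (forall Qs : seq (box R n), all (kbox k) Qs -> 0 <= Lform A B Qs).
Proof.
split=> [[C [_ Ck AC CB]] Qs /allP kQs|LAB].
  (* For [C] the form is a sum of nonnegative box sums; widening the bounds to [A] and [B] can only
     increase it. *)
  have : 0 <= Lform C C Qs.
    by rewrite Lform_diag big_seq; apply: sumr_ge0 => Q /kQs /Ck.
  move/le_trans; apply; rewrite !(LformE _ _ (covers_mult Qs)).
  by apply: ler_sum => y _; apply: cost_le; rewrite num_le; [exact: AC|exact: CB].
pose M := [set mult Qs | Qs in [set Qs | all (@kbox R n k) Qs]]%classic.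
have [|||c [ABc fc]] := @additive_sandwich R (cube R n) M _
  (fun y => (A y)%:num) (fun y => (B y)%:num).
- move=> _ _ [Qs kQs <-] [Qs' kQs' <-]; exists (Qs ++ Qs'); last exact: mult_cat.
  by rewrite /= all_cat; apply/andP.
- by move=> y; rewrite num_le; exact: hAB.
- by move=> _ s [Qs kQs <-] cs; rewrite -LformE//; exact: LAB.
have c01 y : 0 <= c y <= 1.
  have /andP[Ac cB] := ABc y.
  by rewrite (le_trans (ge0 _) Ac)// (le_trans cB (le1 _)).
(* The sandwich theorem yields a real-valued function; the bounds [A] and [B] place it in the unit
   interval. *)
pose C y : {i01 R} := Itv01 (andP (c01 y)).1 (andP (c01 y)).2.
have AC y : A y <= C y by rewrite -num_le; have /andP[] := ABc y.
have CB y : C y <= B y by rewrite -num_le; have /andP[] := ABc y.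
have Ck : k_increasing k C.
  move=> Q kQ; have := Lform_diag C [:: Q]; rewrite big_seq1 => <-.
  rewrite (LformE _ _ (covers_mult _)); apply: fc; last exact: covers_mult.
  by exists [:: Q] => //=; rewrite kQ.
have [A0 _ Am] := hA; have [B0 _ Bm] := hB.
have C0 : grounded C.
  by move=> x i xi; apply/le_anti; rewrite -{1}(B0 x i xi) -{1}(A0 x i xi) CB AC.
exists C; split=> //; split=> //; first exact: grounded_k_increasing1 Ck.
move=> i t; apply/le_anti/andP; split.
  by rewrite -[leRHS](Bm i t); exact: CB.
by rewrite -[leLHS](Am i t); exact: AC.
Qed.
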